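(* Let $s \geq 2$ be an integer and $k \geq 1$ real. Let $G$ be a $K_{s+1}$-free graph with $\iota(G) > 18k + 4$. Then $G$ contains cycles of at least $\frac{1}{2}(k/s)^{s/(s-1)}$ consecutive lengths, i.e. there is an integer $m$ such that $G$ contains a cycle of length $\ell$ for every integer $\ell$ with $m \le \ell < m + \frac12 (k/s)^{s/(s-1)}$.
   Context: All graphs are finite and simple. For nonempty $X \subseteq V(G)$, $\alpha(X)$ is the independence number of the subgraph induced by $X$, and $\iota(G) := \sup_{\emptyset\neq X \subseteq V(G)} |X|/\alpha(X)$ is the independence ratio. $K_{s+1}$-free means containing no complete subgraph on $s+1$ vertices. *)

(* Defs.v *)
From HB Require Import structures.
From mathcomp Require Import all_boot all_order all_algebra.
From mathcomp Require Import classical_sets reals exp.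

Set Implicit Arguments.
Unset Strict Implicit.
Unset Printing Implicit Defensive.

Import Order.TTheory GRing.Theory Num.Theory.
Local Open Scope ring_scope.

(* A finite simple graph is a finite type of vertices T together with a
   symmetric irreflexive adjacency relation e : rel T. *)

Section Graph.
Variables (T : finType) (e : rel T).

Definition clique (A : {set T}) : bool :=
  [forall x in A, forall y in A, (x != y) ==> e x y].

Definition clique_free (n : nat) : Prop :=
  forall A : {set T}, clique A -> #|A| <> n.

Definition independent (A : {set T}) : bool :=
  [forall x in A, forall y in A, ~~ e x y].

(* The independent sets of the subgraph induced by X are the independent
   sets of the whole graph that are contained in X. *)
Definition indep_num (X : {set T}) : nat :=
  \max_(A : {set T} | (A \subset X) && independent A) #|A|.

(* For nonempty X, indep_num X > 0 since e is irreflexive. *)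
Definition indep_ratio (R : realType) : R :=
  sup [set r : R | exists2 X : {set T},
         X != finset.set0 & r = #|X|%:R / (indep_num X)%:R]%classic.

(* The bound 3 <= l is needed: a single edge x y satisfies
   ucycle e [:: x; y], and the empty sequence is a ucycle as well. *)
Definition has_cycle (l : nat) : Prop :=
  (3 <= l)%N /\ exists2 c : seq T, ucycle e c & size c = l.

End Graph.

(* Main.v *)
(** Let [alpha] be the independence number and [K] a natural number slightly
    above [k].  Level the vertices by their distance to a root of their
    component; the vertices of a set [X] with [6 K alpha(X) < |X|] lying on
    levels of one parity contain a set [Y] minimal for
    [3 K alpha(Y) < |Y|].  Minimality gives expansion: for nonempty [S] in [Y],
    the closed neighbourhood of [S] in [Y] has more than [3 K alpha(S)] elements.
    Taking for [S] the end points of the Posa rotations of a longest path of [Y],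
    this neighbourhood has at most [3 |S|] elements, so [K alpha(S) < |S|], and
    [S] lies on a cycle [C] in [Y].  Since [3 alpha(S) < |S|], the set [S] is not
    3-colourable, so [C] has a chord joining indices of the same parity, and then
    any nonconstant 2-colouring of [C] has bicoloured paths of all lengths up to
    about [|C| / 2].  Edges inside [Y] join vertices of equal level, so [C] lies
    in one level; colouring it by the branches of the tree below the last common
    ancestor turns these paths into cycles of consecutive lengths.  Finally,
    a Ramsey bound for [K_(s+1)]-free graphs bounds [|S|] from below. *)
Require Import Defs.
From HB Require Import structures.
From mathcomp Require Import all_boot all_order all_algebra.
From mathcomp Require Import classical_sets reals exp.
From mathcomp Require Import boolp fintype finset zify lra.

Set Implicit Arguments.
Unset Strict Implicit.
Unset Printing Implicit Defensive.

Import Order.TTheory GRing.Theory Num.Theory.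
Local Open Scope ring_scope.

(** * Periodic functions on the integers *)

Lemma periodicM (f : int -> bool) (p : int) : (forall x : int, f (x + p) = f x) ->
  forall q x : int, f (x + q * p) = f x.
Proof.
move=> fp q; elim/int_rect: q => [x|m IH x|m IH x]; first by rewrite mul0r addr0.
- by rewrite -[RHS]IH -[RHS]fp; congr f; lia.
- by rewrite -[RHS]IH -[LHS]fp; congr f; lia.
Qed.

Lemma periodic_window (f g : int -> bool) (p : nat) (a : int) : (0 < p)%N ->
  (forall x : int, f (x + p%:Z) = f x) -> (forall x : int, g (x + p%:Z) = g x) ->
  (forall x : int, a <= x -> x < a + p%:Z -> f x = g x) -> f =1 g.
Proof.
move=> p_gt0 fp gp fg x.
have xE := divz_eq (x - a) p.
have m0 : 0 <= ((x - a) %% p)%Z by rewrite modz_ge0; lia.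
have m1 : ((x - a) %% p)%Z < p by rewrite ltz_pmod; lia.
have {xE} -> : x = (a + ((x - a) %% p)%Z) + ((x - a) %/ p)%Z * p by lia.
by rewrite !periodicM //; apply: fg; lia.
Qed.

(** * Bicoloured paths in a cycle with a chord *)

Section ChordedCycle.
Variables (n l : nat).

(* [E] is adjacency between the vertices of an [n]-cycle, indexed by integers
   modulo [n], and [f] a colouring; [uni_path] says that the ends of a path of
   length [l] have the same colour.  Indices less than [n] apart and distinct
   denote distinct vertices, so only such index sequences [g] are considered. *)
Record unicolored (E : rel int) (f : int -> bool) : Prop := Unicolored {
  uni_sym : symmetric E;
  uni_succ : forall x : int, E x (x + 1);
  uni_adjn : forall x y : int, E x (y + n%:Z) = E x y;
  uni_per : forall x : int, f (x + n%:Z) = f x;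
  uni_path : forall g : nat -> int,
    (forall t, (t < l)%N -> E (g t) (g t.+1)) ->
    (forall t u, (t < u <= l)%N -> g t != g u /\ `|g t - g u| < n%:Z) ->
    f (g l) = f (g 0%N) }.

Lemma unicolored_shift E f a : unicolored E f ->
  unicolored (fun x y => E (a + x) (a + y)) (fun x => f (a + x)).
Proof.
case=> Es E1 En fn fp; split=> [x y|x|x y|x|g gE gI]; first exact: Es.
- by rewrite /= addrA.
- by rewrite /= addrA En.
- by rewrite /= addrA fn.
apply: (fp (fun t => a + g t)) => // t u tu.
by have [] := gI t u tu; split; lia.
Qed.

Lemma unicolored_opp E f : unicolored E f ->
  unicolored (fun x y => E (- x) (- y)) (fun x => f (- x)).
Proof.
case=> Es E1 En fn fp; split=> [x y|x|x y|x|g gE gI]; first exact: Es.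
- by rewrite Es -[X in E _ X](_ : - (x + 1) + 1 = _) ?E1 //; lia.
- by rewrite -En; congr (E _ _); lia.
- by rewrite -fn; congr f; lia.
apply: (fp (fun t => - g t)) => // t u tu.
by have [] := gI t u tu; split; lia.
Qed.

Hypotheses (l_gt0 : (0 < l)%N) (ltln : (l < n)%N).

(** The arc [x, x + 1, ..., x + l] is itself an admissible path, because [l < n]. *)
Lemma unicolored_period E f : unicolored E f -> forall x : int, f (x + l%:Z) = f x.
Proof.
case=> Es E1 En fn fp x; rewrite (fp (fun t => x + t%:Z)) ?addr0 // => [t _|t u].
  by rewrite -[X in E _ X](_ : x + t%:Z + 1 = _) ?E1 //; lia.
by lia.
Qed.

Lemma chord_shortcut E f (r : nat) : unicolored E f ->
  (2 <= r)%N -> (l + r <= n)%N -> E 0 r -> forall x : int, f (x + r%:Z - 1) = f x.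
Proof.
move=> uEf r2 lrn Er; have fl := unicolored_period uEf.
(* By period [l] only [-l < x <= 0] matters; from there a path of length [l] reaches 0 and still has
   an edge left for the chord. *)
apply: (@periodic_window _ _ l (1 - l%:Z)) => // [x|x x1 x2].
  by rewrite -[RHS]fl; congr f; lia.
case: uEf => Es E1 En fn fp.
(* The path [x, x + 1, ..., 0, r, r + 1, ..., x + r - 1 + l]. *)
have := fp (fun t => if (t%:Z <= - x) then x + t%:Z else x + r%:Z - 1 + t%:Z).
have -> : (l%:Z <= - x) = false by lia.
have -> : (0%:Z <= - x) by lia.
rewrite addr0 fl; apply => [t tl|t u tu]; last by do 2?case: ifP; lia.
have [h1|[h1|h1]] : (t.+1%:Z <= - x) \/ (t%:Z = - x \/ - x < t%:Z) by lia.
- rewrite h1; have -> : (t%:Z <= - x) by lia.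
  by rewrite -[X in E _ X](_ : x + t%:Z + 1 = _) ?E1 //; lia.
- have -> : (t.+1%:Z <= - x) = false by lia.
  have -> : (t%:Z <= - x) by lia.
  have -> : x + t%:Z = 0 by lia.
  by have -> : x + r%:Z - 1 + t.+1%:Z = r by lia.
- have -> : (t.+1%:Z <= - x) = false by lia.
  have -> : (t%:Z <= - x) = false by lia.
  by rewrite -[X in E _ X](_ : x + r%:Z - 1 + t%:Z + 1 = _) ?E1 //; lia.
Qed.

Lemma chord_reflection E f (r : nat) : unicolored E f ->
  (2 <= r <= l)%N -> (l + r <= n)%N -> E 0 r -> forall x : int, f (- x) = f x.
Proof.
move=> uEf /andP[r2 rl] lrn Er; have fl := unicolored_period uEf.
have fr := chord_shortcut uEf r2 lrn Er.
(* By [chord_shortcut], [r - 1] is a period. For [0 <= x < r - 1] the descent from [x] to 0 stays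
   below [r], and [r <= l] leaves an edge for the chord. *)
apply: (@periodic_window _ _ r.-1 0); [lia| | |] => [x|x|x x1 x2].
- by rewrite -fr; congr f; lia.
- by rewrite -[RHS]fr; congr f; lia.
case: uEf => Es E1 En fn fp.
(* The path [x, x - 1, ..., 0, r, r + 1, ..., r - 1 - x + l]. *)
have := fp (fun t => if (t%:Z <= x) then x - t%:Z else r%:Z - 1 - x + t%:Z).
have -> : (l%:Z <= x) = false by lia.
have -> : (0%:Z <= x) by lia.
rewrite subr0 fl => fpx.
rewrite -{}fpx => [|t tl|t u tu]; [by rewrite -fr; congr f; lia| |
  by do 2?case: ifP; lia].
have [h1|[h1|h1]] : (t.+1%:Z <= x) \/ (t%:Z = x \/ x < t%:Z) by lia.
- rewrite h1; have -> : (t%:Z <= x) by lia.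
  by rewrite Es -[X in E _ X](_ : x - t.+1%:Z + 1 = _) ?E1 //; lia.
- have -> : (t.+1%:Z <= x) = false by lia.
  have -> : (t%:Z <= x) by lia.
  have -> : x - t%:Z = 0 by lia.
  by have -> : r%:Z - 1 - x + t.+1%:Z = r by lia.
- have -> : (t.+1%:Z <= x) = false by lia.
  have -> : (t%:Z <= x) = false by lia.
  by rewrite -[X in E _ X](_ : r%:Z - 1 - x + t%:Z + 1 = _) ?E1 //; lia.
Qed.

(* If [r <= l], the reflections at both ends of the chord compose to a
   translation by 2; otherwise the two ways around the cycle yield the periods
   [r - 1] and [n - r - 1]. *)
Lemma short_chord_period E f (r : nat) : unicolored E f ->
  (2 <= r)%N -> (r.*2 <= n)%N -> (l.*2 <= n.+1)%N -> E 0 r ->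
  forall x : int, f (x + 2) = f x.
Proof.
move=> uEf r2 rn ln Er x; have lrn : (l + r <= n)%N by lia.
have fr := chord_shortcut uEf r2 lrn Er.
have [rl|lr] := leqP r l.
  have fN : forall x : int, f (- x) = f x.
    by apply: (chord_reflection uEf) => //; lia.
  have uE' := unicolored_opp (unicolored_shift r uEf).
  have Er' : E (r%:Z + - 0) (r%:Z + - r%:Z) by rewrite subr0 subrr (uni_sym uEf).
  have fN' : f (r%:Z + - - (x + 1)) = f (r%:Z + - (x + 1)).
    by apply: (chord_reflection uE' _ _ Er'); lia.
  have <- : f (r%:Z + - (x + 1)) = f x by rewrite -[RHS]fN -[RHS]fr; congr f; lia.
  by rewrite -fN' -[LHS]fr; congr f; lia.
have uE' := unicolored_shift r uEf.
have Er' : E (r%:Z + 0) (r%:Z + (n - r)%N%:Z).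
  rewrite addr0.
  have -> : r%:Z + (n - r)%N%:Z = 0 + n%:Z by lia.
  by rewrite (uni_adjn uEf) (uni_sym uEf).
have fr' (y : int) : f (r%:Z + (y + (n - r)%N%:Z - 1)) = f (r%:Z + y).
  by apply: (chord_shortcut uE' _ _ Er') => //; lia.
(* The periods [r - 1] and [n - r - 1] add up to [n - 2], and [n] is a period. *)
have <- : f (r%:Z + (x + 1)) = f x.
  by rewrite -fr' -[RHS](uni_per uEf); congr f; lia.
by rewrite -fr; congr f; lia.
Qed.

End ChordedCycle.

(** * Cyclic sequences indexed by the integers *)

Lemma cycle_nth (T : eqType) (e : rel T) (c : seq T) (x0 : T) i :
  cycle e c -> (i < size c)%N ->
  e (nth x0 c i) (nth x0 c (if i.+1 == size c then 0 else i.+1)%N).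
Proof.
case: c => //= a s /(pathP x0)/(_ i); rewrite size_rcons => h /[dup] lti /h.
rewrite -rcons_cons !nth_rcons lti /= eqSS.
by have [||] := ltngtP i (size s) => //; lia.
Qed.

Section CyclicIndex.
Variables (T : eqType) (c : seq T) (x0 : T).
Hypothesis c_gt0 : (0 < size c)%N.

Definition cyc_nth (x : int) : T := nth x0 c `|(x %% size c)%Z|.

Lemma cyc_index_lt (x : int) : (`|(x %% size c)%Z| < size c)%N.
Proof.
have m0 : 0 <= (x %% size c)%Z by rewrite modz_ge0; lia.
have m1 : (x %% size c)%Z < size c by rewrite ltz_pmod; lia.
by lia.
Qed.

Lemma mem_cyc_nth x : cyc_nth x \in c.
Proof. exact/mem_nth/cyc_index_lt. Qed.

Lemma cyc_nthE (i : nat) : (i < size c)%N -> cyc_nth i = nth x0 c i.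
Proof. by move=> ltic; rewrite /cyc_nth modz_nat modn_small. Qed.

Lemma cyc_nthDn (x : int) : cyc_nth (x + (size c)%:Z) = cyc_nth x.
Proof. by rewrite /cyc_nth modzDr. Qed.

Lemma cyc_nth_inj (x y : int) : uniq c ->
  `|x - y| < (size c)%:Z -> cyc_nth x = cyc_nth y -> x = y.
Proof.
move=> c_uniq xy /eqP; rewrite nth_uniq ?cyc_index_lt // => /eqP h.
have h' : (x %% size c)%Z = (y %% size c)%Z.
  have := modz_ge0 x (_ : (size c)%:Z != 0).
  have := modz_ge0 y (_ : (size c)%:Z != 0).
  by lia.
move/eqP: h'; rewrite eqz_mod_dvd => /dvdzP[q xyq].
have [q0|[q0|q0]] : q <= -1 \/ q = 0 \/ 1 <= q by lia.
- by nia.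
- by rewrite q0 in xyq; lia.
- by nia.
Qed.

Lemma cyc_nth_adj (e : rel T) (x : int) : cycle e c ->
  e (cyc_nth x) (cyc_nth (x + 1)).
Proof.
move=> e_cyc; have := cycle_nth x0 e_cyc (cyc_index_lt x); congr (e _ (nth _ _ _)).
rewrite -modzDml.
have m0 : 0 <= (x %% size c)%Z by rewrite modz_ge0; lia.
have m1 : (x %% size c)%Z < size c by rewrite ltz_pmod; lia.
case: eqP => h; last by rewrite (@modz_small (_ + _)); lia.
  have -> : (x %% size c)%Z + 1 = size c by lia.
  by rewrite modzz.
Qed.

End CyclicIndex.

(** Without such a path the colouring, read along the integers, is [unicolored]. The chord then
    gives period 2, and evenness of [r] gives an odd period as well, so the colouring would be
    constant on [c]. *)
Lemma odd_chord_bicolored_path (T : eqType) (e : rel T) (c : seq T) (x0 : T)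
    (chi : T -> bool) (l i r : nat) :
  symmetric e -> cycle e c -> uniq c ->
  (0 < l)%N -> (l.*2 <= (size c).+1)%N ->
  (2 <= r)%N -> ~~ odd r -> (i + r < size c)%N -> (r.+2 <= size c)%N ->
  e (nth x0 c i) (nth x0 c (i + r)) ->
  (exists2 a, a \in c & exists2 b, b \in c & chi a != chi b) ->
  exists x p, [/\ path e x p, uniq (x :: p), {subset x :: p <= c}, size p = l
                & chi (last x p) != chi x].
Proof.
move=> e_sym cyc_c uniq_c l0 ln r2 odd_r irn rn eir [a ac [b bc abN]].
apply: contrapT => noP; set n := size c in ln irn rn.
have n0 : (0 < n)%N by lia.
pose v := cyc_nth c x0.
have uEf : unicolored n l (fun x y => e (v x) (v y)) (chi \o v).
  split=> [x y|x|x y|x|g gE gI] /=; first exact: e_sym.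
  - exact: cyc_nth_adj.
  - by rewrite /v cyc_nthDn.
  - by rewrite /v cyc_nthDn.
  apply: contrapT => /eqP chiN; apply: noP.
  exists (v (g 0%N)), [seq v (g t) | t <- iota 1 l].
  have gtE t : (t <= l)%N ->
      nth (v (g 0%N)) (v (g 0%N) :: [seq v (g t) | t <- iota 1 l]) t = v (g t).
    case: t => //= t tl; rewrite (nth_map 0%N) ?size_iota // nth_iota //.
  split.
  - apply/(pathP (v (g 0%N))) => t; rewrite size_map size_iota => tl.
    rewrite gtE 1?ltnW // -[nth _ _ t]/(nth (v (g 0%N)) (v (g 0%N) :: _) t.+1).
    by rewrite gtE //; apply: gE.
  - rewrite -[_ :: _]/(map (v \o g) (iota 0 l.+1)) map_inj_in_uniq ?iota_uniq //.
    move=> t u; rewrite !mem_iota !add0n /= => tl ul vtu.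
    have [tu|ut|//] := ltngtP t u.
      have [|/eqP gN gd] := gI t u; first by lia.
      by case: gN; apply: (cyc_nth_inj n0 uniq_c _ vtu).
    have [|/eqP gN gd] := gI u t; first by lia.
    by case: gN; apply: (cyc_nth_inj n0 uniq_c _ (esym vtu)).
  - rewrite -[_ :: _]/(map (v \o g) (iota 0 l.+1)) => x /mapP[t _ ->].
    exact: mem_cyc_nth.
  - by rewrite size_map size_iota.
  rewrite -nth_last size_map size_iota.
  by have := gtE l (leqnn l); case: (l) l0 chiN => //= m _ chiN ->.
have ltln : (l < n)%N by lia.
have uEf' := unicolored_shift i uEf.
pose f (x : int) := chi (v (i%:Z + x)).
have fn (x : int) : f (x + n%:Z) = f x by apply: (uni_per uEf').
have Er : e (v (i%:Z + 0)) (v (i%:Z + r%:Z)).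
  rewrite addr0 (_ : i%:Z + r%:Z = (i + r)%N :> int) //.
  by rewrite /v !cyc_nthE //; lia.
have f1 (x : int) : f (x + 1) = f x.
  (* The period lemmas want the shorter of the two arcs cut off by the chord. If it has [r] edges,
     then [r - 1] is the odd period. *)
  have [rn2|nr2] := leqP r.*2 n.
    have f2 (x' : int) : f (x' + 2) = f x'.
      exact: (short_chord_period l0 ltln uEf' r2 rn2 ln Er).
    have fr (x' : int) : f (x' + r%:Z - 1) = f x'.
      by apply: (chord_shortcut l0 ltln uEf' r2 _ Er); lia.
    rewrite -[RHS]fr -[RHS](periodicM f2 (- (r./2)%:Z + 1)).
    by congr f; lia.
  (* Now the shorter arc has [n - r] edges, a number of unknown parity; the odd period is
     [n - (n - r - 1) = r + 1]. *)
  have uE' := unicolored_shift r uEf'.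
  have Er' : e (v (i%:Z + (r%:Z + 0))) (v (i%:Z + (r%:Z + (n - r)%N%:Z))).
    rewrite addr0 e_sym (_ : _ + (_ + _) = i%:Z + n%:Z); last by lia.
    by move: Er; rewrite addr0 [v (_ + n%:Z)]cyc_nthDn.
  pose f' (x : int) := f (r%:Z + x).
  have nr : (2 <= n - r)%N by lia.
  have f2 (x' : int) : f' (x' + 2) = f' x'.
    by apply: (short_chord_period l0 ltln uE' nr _ ln Er'); lia.
  have fr (x' : int) : f' (x' + (n - r)%N%:Z - 1) = f' x'.
    by apply: (chord_shortcut l0 ltln uE' nr _ Er'); lia.
  have <- : f' (x - r%:Z) = f x by rewrite /f'; congr f; lia.
  rewrite -[RHS]fr -[RHS](periodicM f2 ((r./2)%:Z + 1)) /f' -[LHS]fn.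
  by congr f; lia.
have fc (x : int) : f x = f 0.
  by rewrite -[x]add0r -[x in LHS]mulr1 (periodicM f1).
have chiE z : z \in c -> chi z = f 0.
  move=> zc; rewrite -(fc ((index z c)%:Z - i%:Z)) /f addrC subrK.
  by rewrite /v cyc_nthE ?index_mem // nth_index.
by case/eqP: abN; rewrite !chiE.
Qed.

(** * Trees of levels *)

Section LevelTree.
Local Open Scope nat_scope.
Variables (T : finType) (e : rel T) (lev : T -> nat) (par : T -> T).
Hypotheses (e_sym : symmetric e)
  (parP : forall x, 0 < lev x -> e x (par x) /\ (lev (par x)).+1 = lev x).

Lemma lev_iter_par x i : i <= lev x -> lev (iter i par x) = lev x - i.
Proof.
elim: i => [|i IH] lti; first by rewrite subn0.
have li := IH (ltnW lti).
by have [|_] := @parP (iter i par x); rewrite /=; lia.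
Qed.

Lemma path_traject_par x i : i <= lev x -> path e x (traject par (par x) i).
Proof.
elim: i x => //= i IH x lti.
have [|exp lp] := @parP x; first by lia.
by rewrite exp IH //; lia.
Qed.

Lemma traject_parP x i z :
  reflect (exists2 m, 0 < m <= i & z = iter m par x) (z \in traject par (par x) i).
Proof.
apply: (iffP trajectP) => [[m mi ->]|[[|m] // mi ->]].
  by exists m.+1 => //; rewrite iterSr.
by exists m => //; rewrite -iterSr.
Qed.

Lemma uniq_traject_par x i : i <= lev x -> uniq (traject par (par x) i).
Proof.
case: i => // i ix; rewrite looping_uniq; apply/trajectP => -[m mi].
by rewrite -!iterSr => /(congr1 lev); rewrite !lev_iter_par; lia.
Qed.

(** The path is closed by climbing from both ends to their [j]-th ancestor. The climbs leave level
    [h] at once, and they cannot meet earlier: equal ancestors have equal levels, so they would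
    agree from there on, also at height [j - 1]. *)
Lemma has_cycle_through_ancestor x p h j :
  path e x p -> uniq (x :: p) -> {in x :: p, forall z, lev z = h} ->
  0 < j <= h -> iter j par x = iter j par (last x p) ->
  iter j.-1 par x != iter j.-1 par (last x p) -> has_cycle e (size p + j.*2).
Proof.
move=> exp uxp levh /andP[j0 jh] eqj neqj.
set y := last x p in eqj neqj.
have levx : lev x = h by apply: levh; rewrite mem_head.
have levy : lev y = h by apply: levh; rewrite mem_last.
have p0 : 0 < size p.
  by move: neqj; rewrite /y; case: (p) => //=; rewrite eqxx.
split; first by lia.
(* The climb from [y] includes the common ancestor; the descent to [x] therefore lists only [j - 1]
   ancestors. *)
exists (x :: p ++ traject par (par y) j ++ rev (traject par (par x) j.-1)); last first.
  by rewrite /= !size_cat size_rev !size_traject; lia.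
apply/andP; split.
  rewrite /= rcons_cat cat_path exp /= rcons_cat cat_path path_traject_par ?levy //=.
  have -> : last y (traject par (par y) j) = iter j par x.
    by rewrite last_traject eqj.
  have -> : rcons (rev (traject par (par x) j.-1)) x =
            rev (belast x (traject par (par x) j)).
    case: (j) j0 => // j' _; rewrite trajectSr belast_rcons rev_cons.
    by congr rcons.
  have -> : iter j par x = last x (traject par (par x) j).
    by rewrite last_traject.
  rewrite rev_path (eq_path (e' := e)) ?path_traject_par ?levx //.
rewrite -cat_cons cat_uniq uxp /= cat_uniq rev_uniq.
rewrite !uniq_traject_par ?levx ?levy //=; try lia.
rewrite andbT; apply/andP; split; apply/hasPn => z.
  rewrite mem_cat mem_rev => /orP[] /traject_parP-[m mj ->];
    by apply/negP => /levh; rewrite lev_iter_par; lia.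
rewrite mem_rev => /traject_parP-[m mj ->].
apply/negP => /traject_parP-[m' mj' eqm].
have mm : m = m'.
  by move/(congr1 lev): eqm; rewrite !lev_iter_par; lia.
case/eqP: neqj; rewrite -(subnK (_ : m <= j.-1)); last by lia.
by rewrite !iterD eqm mm.
Qed.

End LevelTree.

Section Levels.
Local Open Scope nat_scope.

(** The level is the distance to the representative of the component, and a parent is a neighbour
    one level lower. The last clause says that climbing all levels from adjacent vertices ends at
    the same root, without naming it. *)
Lemma exists_level_tree (T : finType) (e : rel T) : symmetric e ->
  exists (lev : T -> nat) (par : T -> T),
  [/\ forall x, 0 < lev x -> e x (par x) /\ (lev (par x)).+1 = lev x,
      forall x y, e x y -> lev x <= (lev y).+1
    & forall x y, e x y -> iter (lev x) par x = iter (lev y) par y].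
Proof.
move=> e_sym.
(* [walk n x]: some walk of length [n] leads from [x] to the root of its component. *)
pose walk := fix walk (n : nat) (x : T) : bool :=
  if n is n'.+1 then [exists y, e x y && walk n' y] else x == fingraph.root e x.
have rootE x y : e x y -> fingraph.root e x = fingraph.root e y.
  by move=> exy; apply/eqP; rewrite (root_connect (sym_connect_sym e_sym)) connect1.
have walk_ex x : exists n, walk n x.
  have := connect_root e x; case/connectP => p.
  elim: p x => [|y p IH] x /=; first by move=> _ rx; exists 0; apply/eqP.
  case/andP=> exy pyp; rewrite (rootE _ _ exy) => /(IH _ pyp) [n wn].
  by exists n.+1; apply/existsP; exists y; rewrite exy.
pose lev x := ex_minn (walk_ex x).
have levP x : walk (lev x) x by rewrite /lev; case: ex_minnP.
have lev_min x n : walk n x -> lev x <= n.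
  by move=> wn; rewrite /lev; case: ex_minnP => m _; apply.
have lev_adj x y : e x y -> lev x <= (lev y).+1.
  by move=> exy; apply: lev_min; apply/existsP; exists y; rewrite exy; exact: levP.
pose par x := odflt x [pick y | e x y && ((lev y).+1 == lev x)].
have parP x : 0 < lev x -> e x (par x) /\ (lev (par x)).+1 = lev x.
  rewrite /par; case: pickP => [y /andP[exy /eqP] //|no lx].
  have := levP x; case E: (lev x) lx => [//|n] _ /existsP[y /andP[exy /lev_min yn]].
  by have := no y; have := lev_adj _ _ exy; rewrite exy E; lia.
have rooted n x : lev x = n -> iter n par x = fingraph.root e x.
  elim: n x => [|n IH] x E; first by have := levP x; rewrite E => /eqP.
  have [|exp lp] := parP x; first by rewrite E.
  by rewrite iterSr IH ?(rootE _ _ exp) //; lia.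
by exists lev, par; split=> // x y exy; rewrite !(rooted _ _ erefl) (rootE _ _ exy).
Qed.

(** Take the least [j] for which all of [c] has one [j]-th ancestor. The ancestors at height [j - 1]
    split [c] into several branches, so a path with one end in a chosen branch and the other outside
    closes up through the common ancestor. The offset [2 j] is the same for all [l]. *)
Lemma level_cycle_lengths (T : finType) (e : rel T) (lev : T -> nat) (par : T -> T)
    (c : seq T) (x0 : T) (h i r : nat) :
  symmetric e ->
  (forall x, 0 < lev x -> e x (par x) /\ (lev (par x)).+1 = lev x) ->
  cycle e c -> uniq c -> {in c, forall z, lev z = h} ->
  {in c &, forall y z, iter h par y = iter h par z} ->
  2 <= r -> ~~ odd r -> i + r < size c -> r.+2 <= size c ->
  e (nth x0 c i) (nth x0 c (i + r)) ->
  exists j, forall l, 0 < l -> l.*2 <= (size c).+1 -> has_cycle e (l + j.*2).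
Proof.
move=> e_sym parP cyc_c uniq_c levc rootc r2 odd_r irn rn eir.
have c_gt1 : 1 < size c by lia.
have c_gt0 : 0 < size c by lia.
pose same j := all (fun y => all (fun z => iter j par y == iter j par z) c) c.
have sameP j : reflect {in c &, forall y z, iter j par y = iter j par z} (same j).
  apply: (iffP allP) => [h1 y z /h1/allP h2 /h2/eqP //|h1 y yc].
  by apply/allP => z zc; apply/eqP/h1.
have ex_same : exists j, same j by exists h; apply/sameP.
case: (ex_minnP ex_same) => j /sameP samej minj.
(* [c] has two distinct vertices, so height 0 does not identify them. *)
have j0 : 0 < j.
  case: j samej minj => // same0 _.
  have := same0 (nth x0 c 0) (nth x0 c 1); rewrite !mem_nth //.
  by move/(_ isT isT)/eqP; rewrite /= nth_uniq.
have jh : j <= h by apply: minj; apply/sameP.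
have [a ac [b bc abN]] : exists2 a, a \in c & exists2 b, b \in c &
    iter j.-1 par a != iter j.-1 par b.
  have : ~~ same j.-1 by apply/negP => /minj; lia.
  by case/allPn => a ac /allPn[b bc abN]; exists a => //; exists b.
exists j => l l0 ln.
pose chi z := iter j.-1 par z == iter j.-1 par a.
have [|x [p [exp uxp xpc sp chiN]]] :=
  @odd_chord_bicolored_path _ e c x0 chi l i r e_sym cyc_c uniq_c l0 ln
    r2 odd_r irn rn eir.
  exists a => //; exists b => //.
  by rewrite /chi eqxx [iter _ _ b == _]eq_sym (negPf abN).
rewrite -sp; apply: (has_cycle_through_ancestor (h := h) e_sym parP exp uxp).
- by move=> z /xpc/levc.
- by rewrite j0.
- by apply: samej; apply: xpc; rewrite ?mem_head ?mem_last.
- by apply: contraNneq chiN => eqx; rewrite /chi eqx.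
Qed.

End Levels.

(** * Independence numbers *)

Section Independence.
Local Open Scope nat_scope.
Variables (T : finType) (e : rel T).
Hypotheses (e_sym : symmetric e) (e_irr : irreflexive e).
Implicit Types A S X Y : {set T}.

Lemma independentP A : reflect {in A &, forall x y, ~~ e x y} (independent e A).
Proof.
apply: (iffP forall_inP) => [h x y /h/forall_inP h2 /h2 //|h x xA].
by apply/forall_inP => y yA; apply: h.
Qed.

Lemma cliqueP A : reflect {in A &, forall x y, x != y -> e x y} (clique e A).
Proof.
apply: (iffP forall_inP) => [h x y /h/forall_inP h2 /h2/implyP //|h x xA].
by apply/forall_inP => y yA; apply/implyP/h.
Qed.

Lemma leq_indep_num A X : A \subset X -> independent e A -> #|A| <= indep_num e X.
Proof. by move=> AX iA; apply: leq_bigmax_cond; rewrite AX. Qed.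

Lemma indep_num_attained X :
  exists A, [/\ A \subset X, independent e A & #|A| = indep_num e X].
Proof.
have : 0 < #|[pred A : {set T} | (A \subset X) && independent e A]|.
  apply/card_gt0P; exists set0; rewrite !inE sub0set.
  by apply/independentP => x y; rewrite inE.
case/(eq_bigmax_cond (fun A => #|A|)) => A /andP[AX iA] E.
by exists A.
Qed.

Lemma indep_numS X Y : X \subset Y -> indep_num e X <= indep_num e Y.
Proof.
have [A [AX iA <-]] := indep_num_attained X => XY.
exact: leq_indep_num (subset_trans AX XY) iA.
Qed.

Lemma indep_num_separated X1 X2 Y : X1 \subset Y -> X2 \subset Y ->
  {in X1 & X2, forall x y, x != y /\ ~~ e x y} ->
  indep_num e X1 + indep_num e X2 <= indep_num e Y.
Proof.
move=> X1Y X2Y X12.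
have [A [AX iA <-]] := indep_num_attained X1.
have [B [BX iB <-]] := indep_num_attained X2.
have AB0 : A :&: B = set0.
  apply/setP => x; rewrite !inE; apply/andP => -[xA xB].
  by have [/eqP] := X12 _ _ (subsetP AX _ xA) (subsetP BX _ xB).
have := cardsUI A B; rewrite AB0 cards0 addn0 => <-.
apply: leq_indep_num.
  by rewrite subUset (subset_trans AX) // (subset_trans BX).
apply/independentP => x y; rewrite !inE => /orP[xA|xB] /orP[yA|yB].
- exact: (independentP _ iA).
- by have [] := X12 _ _ (subsetP AX _ xA) (subsetP BX _ yB).
- by have [] := X12 _ _ (subsetP AX _ yA) (subsetP BX _ xB); rewrite e_sym.
- exact: (independentP _ iB).
Qed.

Definition closed_nbh Y S := S :|: [set y in Y | [exists x in S, e x y]].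

(** Let [Y] be minimal and [G] the closed neighbourhood of [S]. No edge joins [S] to [Y :\: G], so
    their independence numbers add up to at most that of [Y]. By minimality [Y :\: G] is small, and
    subtraction leaves the bound for [G]. *)
Lemma exists_critical_subset (K : nat) X : K * indep_num e X < #|X| ->
  exists Y, [/\ Y \subset X, K * indep_num e Y < #|Y|
    & forall S, S \subset Y -> S != set0 -> K * indep_num e S < #|closed_nbh Y S|].
Proof.
move=> KX; pose P Y := K * indep_num e Y < #|Y|.
have [Y /minsetP[PY minY] YX] := minset_exists (KX : P X).
exists Y; split=> // S SY S0.
set G := closed_nbh Y S.
have GY : G \subset Y.
  by rewrite subUset SY; apply/subsetP => y; rewrite !inE => /andP[].
have sepY : indep_num e S + indep_num e (Y :\: G) <= indep_num e Y.
  apply: indep_num_separated => //; first exact: subsetDl.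
  move=> x y xS; rewrite !inE => /andP[+ yY]; rewrite yY negb_or /=.
  case/andP=> yS /existsPn/(_ x); rewrite xS /= => exy; split=> //.
  by apply: contraNneq yS => <-.
have DG : #|Y :\: G| <= K * indep_num e (Y :\: G).
  rewrite leqNgt; apply/negP => /(minY (Y :\: G))/(_ (subsetDl _ _)) YG.
  case/set0Pn: S0 => x xS; have := subsetP SY _ xS.
  by rewrite -YG !inE xS.
have := cardsD Y G; rewrite (setIidPr GY) => cD.
have := subset_leq_card GY; rewrite /P in PY.
have := leq_mul (leqnn K) sepY; rewrite mulnDr; lia.
Qed.

(** Induction on [s]: a maximum independent set [I] of [X] dominates [X], and the neighbourhood of
    each of its vertices has no clique on one vertex fewer. Summing over [I] gives the bound. *)
Lemma card_clique_free_le s X :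
  (forall A, A \subset X -> clique e A -> #|A| <> s.+1) ->
  #|X| <= s * indep_num e X ^ s.
Proof.
elim: s X => [|s IH] X noK.
  rewrite mul0n leqn0 cards_eq0; apply/set0Pn => -[x xX].
  apply: (noK [set x]); rewrite ?sub1set ?cards1 //.
  by apply/cliqueP => y z; rewrite !inE => /eqP-> /eqP->; rewrite eqxx.
have [I [IX iI cI]] := indep_num_attained X.
pose N v := [set y in X | e v y].
have XI : X \subset \bigcup_(v in I) (v |: N v).
  apply/subsetP => x xX; apply: contraT => /bigcupP xN.
  have xNI v : v \in I -> (x != v) && ~~ e v x.
    move=> vI; rewrite -negb_or; apply/negP => h; apply: xN; exists v => //.
    by rewrite !inE xX.
  have xI : x \notin I by apply/negP => /xNI; rewrite eqxx.
  have : #|x |: I| <= indep_num e X.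
    apply: leq_indep_num; first by rewrite subUset sub1set xX.
    apply/independentP => y z; rewrite !inE => /predU1P[->|yI] /predU1P[->|zI].
    - by rewrite e_irr.
    - by have /andP[] := xNI _ zI; rewrite e_sym.
    - by have /andP[] := xNI _ yI.
    - exact: (independentP _ iI).
  by rewrite cardsU1 xI cI ltnn.
have Nle v : v \in I -> #|v |: N v| <= 1 + s * indep_num e X ^ s.
  move=> vI; apply: leq_trans (leq_card_setU _ _) _; rewrite cards1 leq_add2l.
  have NX : N v \subset X by apply/subsetP => y; rewrite inE => /andP[].
  apply: leq_trans (IH _ _) _; last first.
    by rewrite leq_mul2l; case: (s) => [|s'] //; rewrite leq_exp2r // indep_numS.
  move=> A AN /cliqueP clA cA; apply: (noK (v |: A)).
  - by rewrite subUset sub1set (subsetP IX) //= (subset_trans AN).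
  - have vA y : y \in A -> e v y by move/(subsetP AN); rewrite inE => /andP[].
    apply/cliqueP => y z; rewrite !inE => /predU1P[->|yA] /predU1P[->|zA] yz.
    + by rewrite eqxx in yz.
    + exact: vA.
    + by rewrite e_sym vA.
    + exact: clA.
  - rewrite cardsU1 cA; have -> // : v \notin A.
    by apply/negP => /(subsetP AN); rewrite inE e_irr andbF.
apply: leq_trans (subset_leq_card XI) _.
have : #|\bigcup_(v in I) (v |: N v)| <= \sum_(v in I) (1 + s * indep_num e X ^ s).
  elim/big_ind2: _ => [|A a B b hA hB|v vI]; first by rewrite cards0.
    exact: leq_trans (leq_card_setU _ _) (leq_add hA hB).
  exact: Nle.
move/leq_trans; apply; rewrite sum_nat_const cI.
case: (indep_num e X) => // a.
rewrite mulnDr muln1 [s.+1 * _]mulSn expnS mulnCA leq_add2r.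
by rewrite leq_pmulr ?expn_gt0.
Qed.

Lemma exists_odd_chord (c : seq T) x0 S : uniq c -> {subset S <= c} ->
  3 * indep_num e S < #|S| ->
  exists i r, [/\ 2 <= r, ~~ odd r, i + r < size c, r.+2 <= size c
                & e (nth x0 c i) (nth x0 c (i + r))].
Proof.
move=> uniq_c Sc S3; apply: contrapT => noC.
(* If the lemma failed, the parity of the index, with a third colour for the
   last vertex, would be a proper colouring. *)
pose lst := [set z in S | index z c == (size c).-1].
pose od := [set z in S | odd (index z c)].
have idx z : z \in S -> index z c < size c by move/Sc; rewrite index_mem.
have lt_even y z : y \in S -> z \in S -> index y c < index z c ->
    odd (index y c) = odd (index z c) -> (index z c).+1 != size c -> ~~ e y z.
  move=> yS zS yz oyz zl; apply/negP => eyz; apply: noC.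
  have := idx _ zS => zc.
  exists (index y c), (index z c - index y c).
  rewrite subnKC ?(ltnW yz) // !nth_index ?Sc //; split=> //; lia.
have indep_parity A : A \subset S :\: lst ->
    {in A &, forall y z, odd (index y c) = odd (index z c)} -> #|A| <= indep_num e S.
  move=> AS oA; apply: leq_indep_num; first exact: subset_trans AS (subsetDl _ _).
  have AS' y : y \in A -> (y \in S) /\ (index y c).+1 != size c.
    move/(subsetP AS); rewrite !inE => /andP[+ yS]; rewrite yS /= => h.
    by split=> //; have := idx _ yS; lia.
  apply/independentP => y z yA zA.
  have [yS yl] := AS' _ yA; have [zS zl] := AS' _ zA.
  have [yz|zy|yz] := ltngtP (index y c) (index z c).
  - by apply: lt_even => //; apply: oA.
  - by rewrite e_sym; apply: lt_even => //; apply: oA.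
  - by rewrite -(nth_index x0 (Sc _ yS)) yz nth_index ?Sc // e_irr.
have lst1 : #|lst| <= indep_num e S.
  apply: leq_indep_num; first by apply/subsetP => z; rewrite inE => /andP[].
  apply/independentP => y z; rewrite !inE => /andP[yS /eqP yl] /andP[zS /eqP zl].
  by rewrite -(nth_index x0 (Sc _ yS)) yl -zl nth_index ?Sc // e_irr.
have := cardsID lst S; have := cardsID od (S :\: lst).
have := indep_parity ((S :\: lst) :&: od) (subsetIl _ _).
have := indep_parity ((S :\: lst) :\: od) (subsetDl _ _).
have -> : S :&: lst = lst by apply/setIidPr/subsetP => z; rewrite inE => /andP[].
move=> h0 h1.
suff : #|(S :\: lst) :&: od| <= indep_num e S /\
       #|(S :\: lst) :\: od| <= indep_num e S by lia.
split; [apply: h1 | apply: h0] => y z; rewrite !inE.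
  by move=> /and3P[_ _ ->] /and3P[_ _ ->].
by case: (y \in S) (z \in S) => -[] //=; do 2?[case: odd => //=]; rewrite ?andbF.
Qed.

End Independence.

(** * Rotations of longest paths *)

Section Posa.
Local Open Scope nat_scope.

Section Infix.
Variable T : eqType.
Implicit Types (a b x z : T) (s t p : seq T).

Lemma infix2_cat a b s z t :
  infix [:: a; b] (s ++ z :: t) =
  infix [:: a; b] (rcons s z) || infix [:: a; b] (z :: t).
Proof.
elim: s => [|x s IH]; first by rewrite /= andbF.
rewrite cat_cons rcons_cons !infix_consl IH orbA; congr (_ || _ || _).
by case: s {IH} => [|y s] /=; rewrite !prefix0s.
Qed.

Lemma infix2_cons a b z t :
  infix [:: a; b] (z :: t) = (a == z) && prefix [:: b] t || infix [:: a; b] t.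
Proof. by []. Qed.

Lemma infix2_index a b p : uniq p -> infix [:: a; b] p -> index b p = (index a p).+1.
Proof.
move=> up /infixP[s [t pE]]; move: up; rewrite {}pE cat_uniq /= !inE !negb_or.
case/and3P=> _ /and3P[aNs bNs _] /andP[/andP[ab _] _].
rewrite !index_cat (negPf aNs) (negPf bNs) /= !eqxx (negPf ab) addn0.
by rewrite addn1.
Qed.

Lemma infix2_mem a b p : infix [:: a; b] p -> (a \in p) * (b \in p).
Proof.
by case/infixP=> s [t ->]; rewrite !mem_cat !inE !eqxx !orbT.
Qed.

End Infix.

Variables (T : finType) (e : rel T) (Y : {set T}).
Hypotheses (e_sym : symmetric e) (e_irr : irreflexive e).
Implicit Types (p q s t : seq T) (a b u v w x y z : T).

Definition path_in p := [&& sorted e p, uniq p & all (mem Y) p].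

Lemma sorted_cat_cons s z t :
  sorted e (s ++ z :: t) = sorted e (rcons s z) && path e z t.
Proof. by case: s => //= x s; rewrite cat_path rcons_path /= andbA. Qed.

(** A rotation with pivot [z] trades the edge from [z] to its successor for the edge from [z] to the
    end point. The successor becomes the new end point, and the first vertex stays. *)
Inductive rotations P0 : seq T -> Prop :=
| Rot0 : rotations P0 P0
| Rot p z q : rotations P0 (p ++ z :: q) -> e z (last z q) ->
    rotations P0 (p ++ z :: rev q).

Definition rotation_ends P0 : {set T} :=
  [set x | `[< exists p, rotations P0 (rcons p x) >]].

Section Rotations.
Variable P0 : seq T.
Hypotheses (P0in : path_in P0) (P0max : forall p, path_in p -> size p <= size P0).

Local Notation S := (rotation_ends P0).

Lemma rotation_endsP x :
  reflect (exists p, rotations P0 (rcons p x)) (x \in S).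
Proof. by rewrite inE; apply: asboolP. Qed.

Lemma mem_ends p x : rotations P0 (rcons p x) -> x \in S.
Proof. by move=> rp; apply/rotation_endsP; exists p. Qed.

Lemma rotations_perm p : rotations P0 p -> perm_eq p P0.
Proof.
elim=> // {}p z q _ IH _; apply: perm_trans IH.
by rewrite perm_cat2l perm_cons perm_rev.
Qed.

Lemma rotations_path_in p : rotations P0 p -> path_in p.
Proof.
elim=> // {}p z q _ /and3P[sp up Yp] ezq; apply/and3P; split.
- move: sp; rewrite !sorted_cat_cons => /andP[-> pq] /=.
  case/lastP: q pq ezq {up Yp} => [|q x]; first by rewrite e_irr.
  move=> pq; rewrite last_rcons rev_rcons /= => -> /=.
  move/path_sorted: pq; rewrite -rev_sorted rev_rcons /=.
  by rewrite (eq_path (e' := e)) // => u v; rewrite e_sym.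
- by move: up; rewrite !cat_uniq /= !mem_rev rev_uniq has_rev.
- by move: Yp; rewrite !all_cat /= all_rev.
Qed.

Definition adjacent_in p a b := infix [:: a; b] p || infix [:: b; a] p.

(** After the rotation [z] is followed by the old end point, which lies in [S] and so differs from
    [b]; the reversed tail keeps its adjacencies with the order swapped. *)
Lemma rot_infix p z q a b : rotations P0 (p ++ z :: q) -> e z (last z q) ->
  a \notin S -> b \notin S ->
  infix [:: a; b] (p ++ z :: rev q) =
  infix [:: a; b] (rcons p z) || infix [:: b; a] q.
Proof.
move=> rp ezq aS bS; rewrite infix2_cat infix2_cons -(infix_rev _ (rev q)) revK.
case/lastP: q rp ezq => [|q x] rp ezq; first by rewrite e_irr in ezq.
have xS : x \in S by apply: (@mem_ends (p ++ z :: q)); rewrite rcons_cat.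
rewrite rev_rcons /= [b == x](negPf _) ?andbF //.
by apply: contraNneq bS => ->.
Qed.

Lemma infix_notin_ends p z q a b : rotations P0 (p ++ z :: q) -> e z (last z q) ->
  b \notin S ->
  infix [:: a; b] (p ++ z :: q) = infix [:: a; b] (rcons p z) || infix [:: a; b] q.
Proof.
move=> rp ezq bS; rewrite infix2_cat infix2_cons.
case: q rp ezq => [|w q] rp ezq; first by rewrite e_irr in ezq.
have wS : w \in S.
  apply: (@mem_ends (p ++ z :: rev q)); rewrite rcons_cat rcons_cons -rev_cons.
  exact: Rot.
rewrite /= [b == w](negPf _) ?andbF //.
by apply: contraNneq bS => ->.
Qed.

(* A rotation removes and creates a single adjacency, and both involve an end
   point, hence an element of [S]. *)
Lemma adjacent_in_rotations p a b : rotations P0 p -> a \notin S -> b \notin S ->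
  adjacent_in p a b = adjacent_in P0 a b.
Proof.
move=> rp aS bS; elim: rp => // {}p z q rp <- ezq.
rewrite /adjacent_in !rot_infix // !(infix_notin_ends _ rp ezq) //.
by rewrite orbACA [X in _ || X]orbC -orbACA.
Qed.

Lemma rotations_head p x : rotations P0 p -> head x p = head x P0.
Proof. by elim=> // {}p z q _ <- _; case: p. Qed.

Lemma ends_nbr_mem p x y : rotations P0 (rcons p x) -> y \in Y -> e x y ->
  y \in rcons p x.
Proof.
move=> rp yY exy; apply: contraT => yp.
have /and3P[sp up Yp] := rotations_path_in rp.
suff /P0max : path_in (rcons (rcons p x) y).
  by rewrite size_rcons (perm_size (rotations_perm rp)) ltnn.
apply/and3P; split.
- by rewrite -cats1 -cats1 -catA /= sorted_cat_cons -cats1 cats1 sp /= exy.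
- by rewrite rcons_uniq yp.
- by rewrite all_rcons Yp /= yY.
Qed.

(** Rotating at [y] puts its current successor [w] into [S]. If both neighbours [u], [v] of [y] on
    [P0] were outside [S], they would still be next to [y] on the rotated path; neither is [w], so
    both would be the one predecessor of [y]. *)
Lemma ends_nbr_adjacent x y : x \in S -> y \in Y -> y \notin S -> e x y ->
  exists2 u, u \in S & adjacent_in P0 u y.
Proof.
move=> /rotation_endsP[q rq] yY yS exy.
have yp := ends_nbr_mem rq yY exy.
have yq : y \in q.
  move: yp; rewrite mem_rcons inE => /predU1P[yx|//].
  by rewrite yx e_irr in exy.
have /and3P[_ up _] := rotations_path_in rq.
have /and3P[_ u0 _] := P0in.
case/splitPr: yq rq up yp => p1 p2 rq up yp.
have [w [p3 pE]] : exists w p3, rcons p2 x = w :: p3.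
  by case: p2 {rq up yp} => [|w p2]; [exists x, [::]|exists w, (rcons p2 x)].
have rq' : rotations P0 (p1 ++ y :: w :: p3) by rewrite -pE -rcons_cons -rcons_cat.
have lx : last y (w :: p3) = x by rewrite -pE last_rcons.
have wS : w \in S.
  apply: (@mem_ends (p1 ++ y :: rev p3)); rewrite rcons_cat rcons_cons -rev_cons.
  by apply: Rot => //; rewrite lx e_sym.
have pyw : infix [:: y; w] (rcons (p1 ++ y :: p2) x).
  by rewrite rcons_cat rcons_cons pE infix2_cat infix2_cons /= !eqxx prefix0s orbT.
set p := rcons _ _ in rq up yp pyw.
have y0 : y \in P0 by rewrite -(perm_mem (rotations_perm rq)).
have [q1 [t P0E]] : exists q1 t, P0 = q1 ++ y :: t.
  by case/splitPr: y0 => q1 t; exists q1, t.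
(* If [y] ended [P0], it would belong to [S]. *)
case: t P0E => [|v q2] P0E.
  case/negP: yS; apply: (@mem_ends q1); rewrite cats1 in P0E.
  by rewrite -P0E; constructor.
have yv : infix [:: y; v] P0.
  by rewrite P0E infix2_cat infix2_cons /= !eqxx prefix0s orbT.
have [vS|vS] := boolP (v \in S); first by exists v => //; rewrite /adjacent_in yv orbT.
have : adjacent_in p y v by rewrite adjacent_in_rotations // /adjacent_in yv.
case/orP=> pyv.
  have := infix2_index up pyw; rewrite -(infix2_index up pyv).
  move/(@index_inj _ y _ _ _ (infix2_mem pyw).2 (infix2_mem pyv).2) => wv.
  by case/negP: vS; rewrite -wv.
(* Rotations keep the first vertex, and [y] has the predecessor [v] in [p], so [y] does not start
   [P0]. *)
have : q1 != [::].
  apply/eqP => q10; have := rotations_head v rq; rewrite P0E q10 /=.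
  have vy := infix2_index up pyv.
  case: (p) vy => [|h p'] //= vy hy; rewrite hy eqxx in vy.
  by case: eqP vy.
case/lastP: q1 P0E => // q1 u P0E _.
have uy : infix [:: u; y] P0.
  by rewrite P0E -cats1 -catA infix2_cat infix2_cons /= !eqxx prefix0s orbT.
have [uS|uS] := boolP (u \in S); first by exists u => //; rewrite /adjacent_in uy.
have : adjacent_in p u y by rewrite adjacent_in_rotations // /adjacent_in uy.
case/orP=> puy.
  have := infix2_index up puy; rewrite (infix2_index up pyv) => -[].
  move/(@index_inj _ y _ _ _ (infix2_mem pyv).1 (infix2_mem puy).1) => vu.
  move: (infix2_index u0 uy) (infix2_index u0 yv); rewrite vu.
  by move: (index _ P0) (index _ P0) => m n; clear; lia.
have := infix2_index up pyw; rewrite -(infix2_index up puy).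
move/(@index_inj _ y _ _ _ (infix2_mem pyw).2 (infix2_mem puy).2) => wu.
by case/negP: uS; rewrite -wu.
Qed.

Lemma rotation_ends_mem x : x \in S -> x \in P0.
Proof.
case/rotation_endsP=> p rp; rewrite -(perm_mem (rotations_perm rp)).
by rewrite mem_rcons mem_head.
Qed.

Lemma path_in_sub p x : path_in p -> x \in p -> x \in Y.
Proof. by case/and3P=> _ _ /allP h /h. Qed.

Lemma card_closed_nbh_ends : #|closed_nbh e Y S| <= 3 * #|S|.
Proof.
(* Where [u] has no successor or predecessor on [P0], these return [u] itself, which does not hurt
   an upper bound on the images. *)
pose nxt u := nth u P0 (index u P0).+1; pose prv u := nth u P0 (index u P0).-1.
have /and3P[_ u0 _] := P0in.
suff /subset_leq_card : closed_nbh e Y S \subset S :|: (nxt @: S :|: prv @: S).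
  move/leq_trans; apply; apply: leq_trans (leq_card_setU _ _) _.
  rewrite mulSn leq_add2l; apply: leq_trans (leq_card_setU _ _) _.
  by rewrite mulSn mul1n leq_add // leq_imset_card.
apply/subsetP => y; rewrite /closed_nbh in_setU => /orP[yS|].
  by rewrite in_setU yS.
rewrite inE => /andP[yY /existsP[x /andP[xS exy]]].
have [yS|yS] := boolP (y \in S); first by rewrite in_setU yS.
have [u uS uy] := ends_nbr_adjacent xS yY yS exy.
rewrite !in_setU; apply/orP; right; apply/orP; case/orP: uy => uy; [left|right].
  apply/imsetP; exists u => //; rewrite /nxt -(infix2_index u0 uy).
  by rewrite nth_index // (infix2_mem uy).
apply/imsetP; exists u => //; rewrite /prv (infix2_index u0 uy) /=.
by rewrite nth_index // (infix2_mem uy).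
Qed.

(* Vertices of [P0] before the first neighbour of an end point are never pivots. *)
Lemma rotations_prefix q1 y t p : P0 = rcons q1 y ++ t ->
  {in q1, forall z x, x \in S -> ~~ e z x} -> rotations P0 p ->
  take (size q1).+1 p = rcons q1 y.
Proof.
move=> P0E q1S; elim=> [|{}p z q rp IH ezq].
  by rewrite P0E take_size_cat // size_rcons.
have := IH; rewrite -!cat_rcons.
have [lp|lp _] := leqP (size q1) (size p).
  by rewrite !takel_cat // size_rcons.
have lastS : last z q \in S.
  by case/lastP: q rp {ezq IH} => [|q x] rp; rewrite ?last_rcons;
    [apply: (@mem_ends p); rewrite -cats1|
     apply: (@mem_ends (p ++ z :: q)); rewrite rcons_cat].
have zq1 : z \in q1.
  have := congr1 (fun s => nth z s (size p)) IH.
  rewrite nth_take 1?ltnW // nth_cat ltnn subnn /= nth_rcons lp => ->.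
  exact: mem_nth.
by have := q1S _ zq1 _ lastS; rewrite ezq.
Qed.

(** Let [y] be the first vertex of [P0] with a neighbour [x] in [S]. All rotations fix [P0] up to
    [y], so the end points all lie from [y] onwards, and the rotated path ending at [x] closes there
    to a cycle. *)
Lemma rotation_ends_cycle :
  (exists x y, [/\ x \in S, y \in Y & e x y]) ->
  exists c, [/\ cycle e c, uniq c, {subset S <= c} & {subset c <= Y}].
Proof.
case=> x0 [y0 [x0S y0Y exy0]].
pose N := [pred y | (y \in Y) && [exists x in S, e x y]].
have hasN : has N P0.
  apply/hasP; exists y0; last first.
    by rewrite /= y0Y; apply/existsP; exists x0; rewrite x0S.
  have /rotation_endsP[p rp] := x0S.
  by rewrite -(perm_mem (rotations_perm rp)); apply: ends_nbr_mem rp _ _.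
have [q1 [y [t [P0E Ny q1N]]]] : exists q1 y t,
    [/\ P0 = rcons q1 y ++ t, N y & ~~ has N q1].
  by case: (split_find hasN) => y q1 t Ny q1N; exists q1, y, t.
have /and3P[_ u0 _] := P0in.
have q1S : {in q1, forall z x, x \in S -> ~~ e z x}.
  move=> z zq1 x xS; apply/negP => ezx; case/hasP: q1N; exists z => //=.
  have zP0 : z \in P0 by rewrite P0E mem_cat mem_rcons inE zq1 orbT.
  rewrite (path_in_sub P0in zP0).
  by apply/existsP; exists x; rewrite xS e_sym.
have prefixE p : rotations P0 p -> exists t', p = q1 ++ y :: t'.
  move=> rp; exists (drop (size q1).+1 p).
  by rewrite -cat_rcons -(rotations_prefix P0E q1S rp) cat_take_drop.
have [yY /existsP[x /andP[xS exy]]] := andP Ny.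
have /rotation_endsP[p rp] := xS.
have [c pE] := prefixE _ rp.
have lastc : last y c = x by have := congr1 (last x) pE; rewrite last_rcons last_cat.
have /and3P[sp up Yp] := rotations_path_in rp.
exists (y :: c); split.
- by move: sp; rewrite pE sorted_cat_cons /= rcons_path lastc exy => /andP[_ ->].
- by move: up; rewrite pE cat_uniq => /and3P[].
- move=> x' x'S; have := x'S; case/rotation_endsP => p' rp'.
  have [c' pE'] := prefixE _ rp'.
  have x'c' : x' \in y :: c'.
    have := congr1 (last x') pE'; rewrite last_rcons last_cat /= => ->.
    exact: mem_last.
  have /and3P[_ up' _] := rotations_path_in rp'.
  have x'q1 : x' \notin q1.
    by move: up'; rewrite pE' cat_uniq => /and3P[_ /hasPn/(_ _ x'c')].
  have := rotation_ends_mem x'S.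
  by rewrite -(perm_mem (rotations_perm rp)) pE mem_cat (negPf x'q1).
- move=> z zc; apply/(path_in_sub (rotations_path_in rp)).
  by rewrite pE mem_cat zc orbT.
Qed.

End Rotations.

Lemma rotation_cycle : Y != set0 -> {in Y, forall x, exists2 y, y \in Y & e x y} ->
  exists (S : {set T}) c,
  [/\ [/\ S != set0, S \subset Y & #|closed_nbh e Y S| <= 3 * #|S|],
    cycle e c, uniq c, {subset S <= c} & {subset c <= Y}].
Proof.
case/set0Pn=> y0 y0Y nbrY.
pose has_size n := `[< exists2 p, path_in p & size p = n >].
have ex_size : exists n, has_size n.
  by exists 1; apply/asboolP; exists [:: y0] => //; rewrite /path_in /= y0Y.
have le_size n : has_size n -> n <= #|T|.
  by case/asboolP=> p /and3P[_ up _] <-; rewrite -(card_uniqP up) max_card.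
case: (ex_maxnP ex_size le_size) => n /asboolP[P0 P0in P0n] nmax.
have P0max p : path_in p -> size p <= size P0.
  by move=> pin; rewrite P0n; apply: nmax; apply/asboolP; exists p.
have [p [x P0E]] : exists p x, P0 = rcons p x.
  case/lastP: (P0) P0max => [|p x _]; last by exists p, x.
  by move/(_ [:: y0]); rewrite /path_in /= y0Y => /(_ isT).
have xS : x \in rotation_ends P0 by apply: (@mem_ends _ p); rewrite -P0E; constructor.
have SY : rotation_ends P0 \subset Y.
  by apply/subsetP => z /rotation_ends_mem; apply: path_in_sub.
have [|c [cyc uc Sc cY]] := rotation_ends_cycle P0in P0max.
  have [y yY exy] := nbrY x (subsetP SY _ xS).
  by exists x, y.
exists (rotation_ends P0), c; split=> //; split=> //.
  by apply/set0Pn; exists x.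
exact: card_closed_nbh_ends.
Qed.
End Posa.

(** * Assembling cycles of consecutive lengths *)

Section ConsecutiveLengths.
Local Open Scope nat_scope.

Lemma cycle_constant (T : eqType) (U : Type) (e : rel T) (f : T -> U) (c : seq T) :
  cycle e c -> {in c &, forall x y, e x y -> f x = f y} ->
  {in c &, forall x y, f x = f y}.
Proof.
case: c => [|a s] //=; rewrite rcons_path => /andP[ps _] fe.
suff fa : {in a :: s, forall x, f x = f a} by move=> x y xc yc; rewrite !fa.
suff H b p : path e b p -> {subset b :: p <= a :: s} ->
  {in b :: p, forall x, f x = f b} by exact: H ps _.
elim: p b => [|d p IH] b /=; first by move=> _ _ x; rewrite inE => /eqP->.
case/andP=> ebd pd sub x; rewrite inE => /predU1P[-> //|xp].
have sub' : {subset d :: p <= a :: s} by move=> z zp; apply: sub; rewrite inE zp orbT.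
rewrite (IH _ pd sub' _ xp); apply/esym/fe => //.
  by apply: sub; rewrite mem_head.
by apply: sub'; rewrite mem_head.
Qed.

Lemma consecutive_cycle_lengths (T : finType) (e : rel T) (K : nat) (X : {set T}) :
  symmetric e -> irreflexive e -> 3 <= K -> 6 * K * indep_num e X < #|X| ->
  exists (S : {set T}) m, K * indep_num e S < #|S| /\
    forall i, i.*2 < #|S| -> has_cycle e (m + i).
Proof.
move=> e_sym e_irr K3 KX.
have [lev [par [parP lev_adj rooted]]] := exists_level_tree e_sym.
have [Z [ZX KZ Zlev]] : exists Z : {set T}, [/\ Z \subset X,
    3 * K * indep_num e Z < #|Z| & {in Z &, forall x y, odd (lev x) = odd (lev y)}].
  pose od := [set x | odd (lev x)].
  have := cardsID od X.
  have [h1|h1] := ltnP (3 * K * indep_num e (X :&: od)) #|X :&: od|.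
    exists (X :&: od); split; rewrite ?subsetIl //.
    by move=> x y; rewrite !inE => /andP[_ ->] /andP[_ ->].
  have [h2|h2] := ltnP (3 * K * indep_num e (X :\: od)) #|X :\: od|.
    exists (X :\: od); split; rewrite ?subsetDl //.
    by move=> x y; rewrite !inE => /andP[/negPf-> _] /andP[/negPf-> _].
  (* If both parity classes failed, each would have at most [3 * K * indep_num e X] elements,
     contradicting the size of [X]. *)
  have h3 := indep_numS e (subsetIl X od); have h4 := indep_numS e (subsetDl X od).
  have h5 := leq_mul (leqnn (3 * K)) h3; have h6 := leq_mul (leqnn (3 * K)) h4.
  lia.
have [Y [YZ KY expand]] := exists_critical_subset e_sym KZ.
have Y0 : Y != set0 by rewrite -card_gt0; apply: leq_ltn_trans KY.
(* An isolated vertex of [Y] would be its own closed neighbourhood, too small for the expansion. *)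
have nbrY : {in Y, forall x, exists2 y, y \in Y & e x y}.
  move=> x xY; apply: contrapT => noy.
  have sx : [set x] \subset Y by rewrite sub1set.
  have := expand _ sx; rewrite -card_gt0 cards1 => /(_ isT).
  have a1 : 1 <= indep_num e [set x].
    rewrite -[1](cards1 x); apply: leq_indep_num => //.
    by apply/independentP => y z; rewrite !inE => /eqP-> /eqP->; rewrite e_irr.
  suff /subset_leq_card : closed_nbh e Y [set x] \subset [set x] by rewrite cards1; nia.
  apply/subsetP => y; rewrite /closed_nbh in_setU => /orP[//|]; rewrite inE.
  case/andP=> yY /existsP[x' /andP[]]; rewrite inE => /eqP-> exy.
  by case: noy; exists y.
have [S [c [[S0 SY cardS] cyc_c uniq_c Sc cY]]] := rotation_cycle e_sym e_irr Y0 nbrY.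
have KS : K * indep_num e S < #|S|.
  by have := leq_trans (expand _ SY S0) cardS; rewrite -mulnA ltn_pmul2l.
have [x0 _] := set0Pn _ S0.
have [|i [r [r2 odd_r irn rn eir]]] := exists_odd_chord e_sym e_irr x0 uniq_c Sc.
  by apply: leq_ltn_trans KS; rewrite leq_mul2r K3 orbT.
(* Levels of adjacent vertices differ by at most 1, and those in [Y] have equal parity. *)
have levE : {in c &, forall x y, lev x = lev y}.
  apply: (cycle_constant cyc_c) => x y xc yc exy.
  have parity := Zlev x y (subsetP YZ _ (cY _ xc)) (subsetP YZ _ (cY _ yc)).
  have eyx : e y x by rewrite e_sym.
  move: (lev_adj _ _ exy) (lev_adj _ _ eyx) parity.
  by move: (lev x) (lev y) => a b; clear; lia.
have rootE : {in c &, forall x y, iter (lev x) par x = iter (lev y) par y}.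
  by apply: (cycle_constant cyc_c) => x y _ _; apply: rooted.
have n0 : nth x0 c 0 \in c by apply/mem_nth/(leq_ltn_trans _ irn).
have [||j jP] := level_cycle_lengths (h := lev (nth x0 c 0)) e_sym parP
  cyc_c uniq_c _ _ r2 odd_r irn rn eir.
- by move=> z zc; apply: levE.
- by move=> y z yc zc; rewrite (levE _ _ n0 yc) {2}(levE _ _ yc zc); apply: rootE.
(* The extra 1 makes the bicoloured path, of length [l + 1], nonempty for [l = 0]. *)
exists S, (j.*2).+1; split=> // l lS.
rewrite addSnnS addnC; apply: jP => //.
suff : #|S| <= size c by lia.
by apply: leq_trans (card_size c); apply/subset_leq_card/subsetP.
Qed.

End ConsecutiveLengths.

(** * Real estimates and the conclusion *)

Lemma powR_ratio_le (R : realType) (s a b : nat) (k : R) :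
  (2 <= s)%N -> 0 <= k -> (0 < a)%N -> k * a%:R <= b%:R -> (b <= s * a ^ s)%N ->
  (k / s%:R) `^ (s%:R / (s%:R - 1)) <= b%:R.
Proof.
case: s => [|[|t]] // _ k0 a0 kab bs; set s := t.+2 in bs *.
have -> : s%:R - 1 = t.+1%:R :> R by rewrite /s -natr1 addrK.
have sR : 0 < s%:R :> R by rewrite ltr0n.
have aR : 0 < a%:R :> R by rewrite ltr0n.
have x0 : 0 <= k / s%:R by rewrite divr_ge0 ?ler0n.
(* The number [a] is eliminated: [b <= (s a)^s] gives [b^s <= b^(s-1) (s a)^s], while [k a <= b]
   gives [(k/s)^s (s a)^s <= b^s]. Cancelling leaves [(k/s)^s <= b^(s-1)]. *)
have bb : b%:R ^+ s <= b%:R ^+ t.+1 * (s * a)%:R ^+ s :> R.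
  rewrite [b%:R ^+ s]exprSr ler_wpM2l ?exprn_ge0 ?ler0n // -natrX ler_nat expnMn.
  apply: leq_trans bs _.
  by rewrite leq_mul2r [X in (_ <= X)%N]expnS leq_pmulr ?expn_gt0 ?orbT.
have xs : (k / s%:R) ^+ s <= b%:R ^+ t.+1.
  have sa0 : 0 < (s * a)%:R ^+ s :> R by rewrite exprn_gt0 // natrM mulr_gt0.
  rewrite -(ler_pM2r sa0); apply: le_trans bb.
  rewrite -exprMn lerXn2r ?nnegrE ?ler0n //; first by rewrite mulr_ge0 ?ler0n.
  by rewrite natrM mulrA divfK ?gt_eqF.
rewrite powRrM powR_mulrn //.
apply: le_trans (ge0_ler_powR _ _ _ xs) _;
  rewrite ?nnegrE ?exprn_ge0 ?invr_ge0 ?ler0n //.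
by rewrite -powR_mulrn ?ler0n // -powRrM divff ?powRr1 ?ler0n // pnatr_eq0.
Qed.

Lemma indep_ratio_gt (R : realType) (T : finType) (e : rel T) (x : R) : 0 <= x ->
  x < indep_ratio e R ->
  exists X : {set T}, x * (indep_num e X)%:R < #|X|%:R.
Proof.
move=> x0; rewrite /indep_ratio; set E := (X in sup X) => xE.
have E0 : (E !=set0)%classic.
  (* The supremum of the empty set is 0 by convention. *)
  by apply: contrapT => E0; move: xE; rewrite sup_out ?ltNge ?x0 //; case.
have [_ [X _ ->] xX] := sup_gt E0 xE; exists X.
have a0 : 0 < (indep_num e X)%:R :> R.
  rewrite lt0r ler0n andbT; apply/eqP => a0.
  by move: xX; rewrite a0 invr0 mulr0 ltNge x0.
by rewrite -ltr_pdivlMr.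
Qed.

Theorem theorem3 (R : realType) (s : nat) (k : R)
    (T : finType) (e : rel T)
    (e_sym : symmetric e) (e_irr : irreflexive e)
    (s_ge2 : (2 <= s)%N) (k_ge1 : 1 <= k)
    (Kfree : clique_free e s.+1)
    (ratio_gt : 18 * k + 4 < indep_ratio e R) :
  exists m : nat, forall l : nat,
    (m <= l)%N ->
    l%:R < m%:R + 2^-1 * (k / s%:R) `^ (s%:R / (s%:R - 1)) ->
    has_cycle e l.
Proof.
have k0 : 0 <= k by lra.
have k18 : 0 <= 18 * k + 4 by lra.
have [X kX] := indep_ratio_gt k18 ratio_gt.
(* This gives [k <= K <= k + 2], and [K >= 3] as the odd chord requires; then
   [6 K <= 6 k + 12 <= 18 k + 4] since [k >= 1]. *)
set K := (Num.truncn k).+2.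
have kK : k <= K%:R.
  by apply: ltW; apply: lt_trans (truncnS_gt k) _; rewrite ltr_nat.
have Kk : K%:R <= k + 2 by rewrite /K -addn2 natrD lerD2r truncn_le.
have K3 : (3 <= K)%N by rewrite !ltnS truncn_gt0.
have KX : (6 * K * indep_num e X < #|X|)%N.
  rewrite -(ltr_nat R); apply: le_lt_trans kX; rewrite natrM ler_wpM2r ?ler0n //.
  by rewrite natrM; lra.
have [S [m [KS mP]]] := consecutive_cycle_lengths e_sym e_irr K3 KX.
have S_le := card_clique_free_le e_sym e_irr (fun A _ => @Kfree A) : (#|S| <= _)%N.
have a0 : (0 < indep_num e S)%N.
  case: posnP S_le KS => // ->; rewrite exp0n ?muln0 ?leqn0; last by lia.
  by move=> /eqP->.
have kS : k * (indep_num e S)%:R <= #|S|%:R.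
  apply: le_trans (ler_wpM2r (ler0n _ _) kK) _.
  by rewrite -natrM ler_nat ltnW.
have fS := powR_ratio_le s_ge2 k0 a0 kS S_le.
exists m => l ml lf; rewrite -(subnKC ml); apply: mP.
rewrite -(ltr_nat R); apply: lt_le_trans fS.
by rewrite -muln2 natrM natrB //; lra.
Qed.
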